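(* Let $A,D,L\ge1$ be integers, let $W,B,T_D>0$ and $\beta\in(0,1]$, and let $\rho_d^{(a)}>0$ for $1\le d\le D$, $1\le a\le A$. Let $\hat h_d^{(a)}\sim\mathcal{CN}\big(0,\,1-\tfrac{1}{1+\rho_d^{(a)}L}\big)$ be independent random variables over all $(d,a)$, and let $$R_d=\beta W\log_2\Big(1+\sum_{a=1}^A\rho_d^{(a)}|\hat h_d^{(a)}|^2\Big),\qquad d=1,\dots,D.$$ Then the probability of time overflow, $\mathbb{P}[\mathsf{TO}]=\mathbb{P}\left[\sum_{d=1}^D\frac{B}{R_d}>T_D\right]$, satisfies $$\prod_{d=1}^D\mathbb{P}\left[R_d\le\frac{DB}{T_D}\right]\le\mathbb{P}[\mathsf{TO}]\le1-\prod_{d=1}^D\mathbb{P}\left[R_d>\frac{DB}{T_D}\right].$$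
   Context: $\mathcal{CN}(0,s)$ denotes the circularly symmetric complex Gaussian distribution with mean $0$ and variance $s$ (so $X\sim\mathcal{CN}(0,s)$ has $\mathbb{E}|X|^2=s$). $A$ is the number of cooperating access points, $D$ the number of devices, $\rho_d^{(a)}$ the average SNR between access point $a$ and device $d$, $\hat h_d^{(a)}$ the MMSE channel estimate from $L$ pilots, $B$ the payload in bits per device, $W$ the bandwidth, $T_D$ the downlink time budget, $R_d$ the rate selected for device $d$ ($\beta$ is a backoff parameter, $\beta=1$ meaning no backoff), and $B/R_d$ the airtime of device $d$. *)

(* Defs.v *)
From HB Require Import structures.
From mathcomp Require Import all_boot all_order all_algebra.
From mathcomp Require Import all_classical all_reals all_analysis.
From mathcomp Require Export complex.

Set Implicit Arguments.
Unset Strict Implicit.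
Unset Printing Implicit Defensive.

Import Order.TTheory GRing.Theory Num.Theory.
Import numFieldNormedType.Exports.

Local Open Scope classical_set_scope.
Local Open Scope ring_scope.
Local Open Scope complex_scope.

HB.instance Definition _ (R : realType) := isPointed.Build R[i] 0.

(* Borel sigma-algebra of the complex plane, transported from R * R along
   z |-> (Re z, Im z). *)
HB.instance Definition _ (R : realType) := Measurable.copy R[i]
  (g_sigma_algebra_preimageType
    ((fun z => (complex.Re z, complex.Im z)) : R[i] -> (R * R)%type)).

(* CN(0, s), for s > 0: the real and imaginary parts are independent centred
   Gaussians of variance s / 2 each. The second argument of normal_prob is the
   standard deviation; for s <= 0 the value is junk (normal_prob 0 0 is not a
   Dirac mass). *)
Definition complex_normal_prob (R : realType) (s : R) : set R[i] -> \bar R :=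
  pushforward
    (normal_prob 0 (Num.sqrt (s / 2)) \x normal_prob 0 (Num.sqrt (s / 2)))%E
    (fun xy : R * R => xy.1 +i* xy.2).

(* Equality of measures is only required on measurable sets: the two sides
   may differ elsewhere. *)
Definition has_law d (T : measurableType d) d' (E : measurableType d')
    (R : realType) (P : probability T R) (X : {RV P >-> E})
    (mu : set E -> \bar R) : Prop :=
  forall U : set E, measurable U -> distribution P X U = mu U.

Definition mutually_independent d (T : measurableType d)
    d' (E : measurableType d') (R : realType) (P : probability T R)
    (I : finType) (X : I -> {RV P >-> E}) : Prop :=
  forall (J : {set I}) (U : I -> set E), (forall i, measurable (U i)) ->
    P (\bigcap_(i in [set` J]) (X i @^-1` U i)) =
    (\prod_(i in J) P (X i @^-1` U i))%E.

Definition log2 (R : realType) (x : R) : R := ln x / ln 2.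

Definition rate (R : realType) (beta W : R) (A : nat) (rho : 'I_A -> R)
    (h : 'I_A -> R[i]) : R :=
  beta * W * log2 (1 + \sum_(a < A) rho a * Normc.normc (h a) ^+ 2).

(* The quotient is taken in \bar R, where B / 0 = +oo for B > 0: a device with
   zero rate needs infinite airtime. *)
Definition airtime (R : realType) (B r : R) : \bar R := (B%:E / r%:E)%E.

(* Main.v *)
Require Import Defs.
From HB Require Import structures.
From mathcomp Require Import all_boot all_order all_algebra.
From mathcomp Require Import all_classical all_reals all_analysis.
From mathcomp Require Import measurable_realfun ring.
Import Order.TTheory GRing.Theory Num.Theory.
Import numFieldNormedType.Exports.

(** If every rate exceeds c = D B / T_D, each airtime is at most T_D / D and no
    overflow occurs; if every rate is at most c, each airtime is at least
    T_D / D, so there is overflow unless all rates equal c. The exceptional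
    event is null because no R_d has an atom. The rates of distinct devices are
    functions of disjoint groups of the independent channels, so the
    probabilities of the two intersections are products. *)

Local Open Scope classical_set_scope.
Local Open Scope ring_scope.
Local Open Scope complex_scope.

(** * Independence of groups of variables *)

(** Dynkin's argument, applied to one index at a time. Products over all of [I] also cover
    subfamilies, since [setT] may be chosen at the other indices. *)
Lemma indep_pi_sigma d (T : measurableType d) (R : realType)
    (P : probability T R) (I : finType) (G : I -> set (set T)) :
  (forall i, G i `<=` measurable) -> (forall i, setI_closed (G i)) ->
  (forall i, G i setT) ->
  (forall E : I -> set T, (forall i, G i (E i)) ->
    P (\bigcap_i E i) = (\prod_i P (E i))%E) ->
  forall E : I -> set T, (forall i, <<s G i >> (E i)) ->
    P (\bigcap_i E i) = (\prod_i P (E i))%E.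
Proof.
move=> mG IG GT indG.
have msG i A : <<s G i >> A -> measurable A.
  by apply: (smallest_sub _ (mG i)); exact: sigma_algebra_measurable.
(* The list [s] records the indices already enlarged from the pi-system to its sigma-algebra. *)
suff H (s : seq I) (E : I -> set T) :
    (forall i, if i \in s then <<s G i >> (E i) else G i (E i)) ->
    P (\bigcap_i E i) = (\prod_i P (E i))%E.
  by move=> E sE; apply: (H (enum I)) => i; rewrite mem_enum; exact: sE.
elim: s E => [E GE|k s IHs E GE]; first exact: indG.
have mE i : measurable (E i).
  by have := GE i; case: ifP => _; [exact: msG|exact: mG].
(* Replace the generator at k by an event of its sigma-algebra: both sides are
   finite measures of that event, and they agree on G k by induction. *)
pose Q := (\prod_(j | j != k) P (E j))%E.
have Q_fin : Q \is a fin_num by apply: prode_fin_num => i _; exact: fin_num_measure.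
have Q_ge0 : (0 <= fine Q)%R by apply/fine_ge0/prode_ge0.
pose F : set T := \bigcap_(i in [set~ k]) E i.
have mF : measurable F by apply: fin_bigcap_measurable => //; exact: finite_finset.
have split_k (E' : I -> set T) : (forall i, i != k -> E' i = E i) ->
    (P (\bigcap_i E' i) = (\prod_i P (E' i))%E) <->
    P (E' k `&` F) = (P (E' k) * Q)%E.
  move=> E'E; rewrite (bigcap_setD1 k)// setTD (bigD1 k)//=.
  rewrite (eq_bigr (fun i => P (E i))) => [|i ik]; last by rewrite E'E.
  rewrite (@eq_bigcapr _ _ [set~ k] E' E) // => i /= ik.
  by rewrite E'E//; exact/eqP.
apply/(split_k E) => //.
pose m1 : measure T R := mrestr P mF.
pose m2 : measure T R := mscale (NngNum Q_ge0) P.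
have m2E A : m2 A = (P A * Q)%E by rewrite /m2 /= /mscale/= fineK// muleC.
have sGk : <<s G k >> (E k).
  have := GE k; rewrite inE eqxx /=; exact.
suff -> : P (E k `&` F) = m2 (E k) by rewrite m2E.
rewrite -[LHS]/(m1 (E k)).
apply: (@g_sigma_algebra_measure_unique _ _ _ (G k) _ (fun=> setT)) => //.
- exact: bigcup_const.
- move=> A GA; rewrite m2E -[LHS]/(P (A `&` F)).
  pose E' i := if i == k then A else E i.
  have := split_k E'; rewrite /E' eqxx => -[].
    by move=> i /negbTE ->.
  move=> + _; apply; apply: IHs => i.
  (* The index [k] may recur in [s]; membership in [G k] is then weakened to [<<s G k >>]. *)
  have := GE i; rewrite inE; case: eqVneq => [->|ik]/=.
    by move=> _; case: ifP => _ //; exact: sub_sigma_algebra.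
  by [].
- by move=> _; rewrite -[X in (X < _)%E]/(P (setT `&` F)) ltey_eq fin_num_measure ?setTI.
Qed.

(* A pi-system generating the sigma-algebra of the group of variables X i with
   g i = k. *)
Definition fiber_rectangles {d} {T : measurableType d} {d'}
    {E : measurableType d'} {R : realType} {P : probability T R} {I K : finType}
    (X : I -> {RV P >-> E}) (g : I -> K) (k : K) : set (set T) :=
  [set S | exists2 U : I -> set E, (forall i, measurable (U i)) &
           S = \bigcap_(i in [set i | g i = k]) X i @^-1` U i].

Section fiber_rectangles.
Context d (T : measurableType d) d' (E : measurableType d') (R : realType).
Context (P : probability T R) (I K : finType) (X : I -> {RV P >-> E}).
Context (g : I -> K).
Local Notation G k := (fiber_rectangles X g k).

Lemma measurable_preimage_RV i (U : set E) :
  measurable U -> measurable (X i @^-1` U).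
Proof. by move=> mU; rewrite -[_ @^-1` _]setTI; exact: measurable_funP. Qed.

Lemma fiber_rectangles_measurable k : G k `<=` measurable.
Proof.
move=> _ [U mU ->]; apply: fin_bigcap_measurable => [|i _].
  exact: finite_finset.
exact: measurable_preimage_RV.
Qed.

Lemma fiber_rectanglesI k : setI_closed (G k).
Proof.
move=> _ _ [U mU ->] [V mV ->]; exists (fun i => U i `&` V i).
  by move=> i; exact: measurableI.
by rewrite -bigcapI.
Qed.

Lemma fiber_rectanglesT k : G k setT.
Proof. by exists (fun=> setT) => //; rewrite bigcapT. Qed.

(** A preimage under [X i] is a rectangle whose other sides are all [setT]. Functions of one group
    thus become measurable for the sigma-algebra of that group. *)
Lemma fiber_rectangles_RV i k : g i = k ->
  measurable_fun setT (X i : g_sigma_algebraType (G k) -> E).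
Proof.
move=> <- _ U mU; rewrite setTI; apply: sub_sigma_algebra.
exists (fun j => if j == i then U else setT) => [j|]; first by case: ifP.
apply/seteqP; split=> [t Xt j _|t /(_ i erefl)] /=; last by rewrite eqxx.
by case: eqVneq => [->|].
Qed.

Lemma mutually_independent_fibers : mutually_independent X ->
  forall F : K -> set T, (forall k, <<s G k >> (F k)) ->
    P (\bigcap_k F k) = (\prod_k P (F k))%E.
Proof.
move=> indX; apply: indep_pi_sigma.
- exact: fiber_rectangles_measurable.
- exact: fiber_rectanglesI.
- exact: fiber_rectanglesT.
move=> F GF.
have {GF} /choice [U UF] : forall k, exists U : I -> set E,
    (forall i, measurable (U i)) /\
    F k = \bigcap_(i in [set i | g i = k]) X i @^-1` U i.
  by move=> k; have [U mU FU] := GF k; exists U.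
(* Each [i] lies in exactly one group, so the rectangles of all groups combine into a single
   rectangle over [I]. *)
have -> : \bigcap_k F k = \bigcap_(i in [set` [set: I]%SET]) X i @^-1` U (g i) i.
  apply/seteqP; split=> [t Ft i _|t Xt k _].
    by have := Ft (g i) Logic.I; rewrite (UF (g i)).2; exact.
  by rewrite (UF k).2 => i /= <-; apply: Xt => /=; rewrite inE.
rewrite (indX _ (fun i => U (g i) i)); last by move=> i; exact: (UF _).1.
(* The product is split along the fibers of [g]; independence, used backwards on each fiber,
   reassembles [P (F k)]. *)
rewrite (partition_big g xpredT)//=; apply: eq_bigr => k _.
transitivity (\prod_(i in [set i | g i == k]%SET) P (X i @^-1` U k i))%E.
  rewrite (eq_bigl (fun i => g i == k)) => [|i]; last by rewrite inE.
  rewrite [RHS](eq_bigl (fun i => g i == k)) => [|i]; last by rewrite inE.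
  by apply: eq_bigr => i /eqP ->.
rewrite -indX; last by move=> i; exact: (UF _).1.
congr (P _); rewrite (UF k).2.
by apply/seteqP; split=> t Xt i /= ik; apply: Xt => /=; move: ik;
  rewrite inE => /eqP.
Qed.

End fiber_rectangles.

(** * Null level sets *)

Section no_atoms.
Context (R : realType).

(** At most two points satisfy the equation, and the normal law is absolutely continuous with
    respect to Lebesgue measure. *)
Lemma normal_prob_sqr0 (m sigma v : R) :
  normal_prob m sigma [set y | y ^+ 2 = v] = 0%E.
Proof.
have cS : countable [set y : R | y ^+ 2 = v].
  apply: (@sub_countable _ _ _ [set Num.sqrt v; - Num.sqrt v]).
    apply: subset_card_le => y /= yv.
    have : (y == Num.sqrt v) || (y == - Num.sqrt v).
      by rewrite -eqf_sqr -yv sqr_sqrtr ?sqr_ge0.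
    by move=> /orP[/eqP|/eqP]; [left|right].
  exact/finite_set_countable/finite_set2.
have mS : measurable [set y : R | y ^+ 2 = v] by exact: countable_measurable.
move/null_content_dominatesP: (normal_prob_dominates m sigma); apply=> //.
exact: countable_lebesgue_measure0.
Qed.

(** By Fubini: once the real part [x] is fixed, the imaginary part must have square
    [a^-1 * k - x ^+ 2], a null event. *)
Lemma complex_normal_prob_circle0 (s a k : R) : a != 0 ->
  complex_normal_prob s [set z | a * Normc.normc z ^+ 2 = k] = 0%E.
Proof.
move=> a0; rewrite /complex_normal_prob /pushforward /product_measure1.
rewrite integral0_eq// => x _ /=.
rewrite -[RHS](normal_prob_sqr0 0 (Num.sqrt (s / 2)) (a^-1 * k - x ^+ 2)).
congr (normal_prob _ _ _); apply/seteqP; split => y /=; rewrite /xsection/= inE/=.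
  rewrite sqr_sqrtr ?addr_ge0 ?sqr_ge0// => <-.
  by rewrite mulKf// addrC addKr.
move=> yE; rewrite sqr_sqrtr ?addr_ge0 ?sqr_ge0// yE addrCA subrr addr0.
by rewrite mulVKf.
Qed.
End no_atoms.

Lemma sum_no_atoms d (T : measurableType d) (R : realType) (P : probability T R)
    (X Y : {RV P >-> R}) (c : R) :
  (forall A B, measurable A -> measurable B ->
    P (X @^-1` A `&` Y @^-1` B) = (P (X @^-1` A) * P (Y @^-1` B))%E) ->
  (forall k, P (X @^-1` [set k]) = 0%E) ->
  P [set t | X t + Y t = c] = 0%E.
Proof.
move=> indXY X0.
(* [Y] comes first because [product_measure1] integrates over the first coordinate, which leaves
   sections in the atomless variable [X]. *)
have mYX : measurable_fun setT (fun t => (Y t, X t)).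
  by apply: measurable_fun_pair; exact: measurable_funPT.
pose S : set (R * R) := [set yx | yx.2 + yx.1 = c].
have mS : measurable S.
  have mf : measurable_fun setT (fun yx : R * R => yx.2 + yx.1).
    by apply: measurable_funD; [exact: measurable_snd|exact: measurable_fst].
  by have := mf measurableT [set c] (measurable_set1 c); rewrite setTI.
(* By independence (Y, X) has the product law, under which every section of the
   line S is a single point. *)
pose m' : measure (R * R)%type R := pushforward P (fun t => (Y t, X t)).
rewrite -[LHS]/(m' mYX S).
rewrite -(@product_measure_unique _ _ _ _ _ (distribution P Y) (distribution P X)) //.
  rewrite /product_measure1 integral0_eq// => y _ /=.
  rewrite -[RHS](X0 (c - y)) /distribution/pushforward; congr (P _).
  apply/seteqP; split => t /=; rewrite /xsection/= inE/S/=.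
    by move=> <-; rewrite addrK.
  by move=> ->; rewrite subrK.
move=> A B mA mB; rewrite muleC -indXY// setIC.
exact.
Qed.

(** * Measurability and monotonicity of rates and airtimes *)

Section rate_airtime.
Context (R : realType).
Implicit Types (B c r : R).

Lemma measurable_normc : measurable_fun setT (@Normc.normc R).
Proof.
pose ReIm (z : R[i]) : R * R := (complex.Re z, complex.Im z).
have mReIm : measurable_fun setT ReIm.
  (* The measurable sets of [R[i]] are by construction the preimages under [ReIm]. *)
  by move=> _ U mU; exists U.
have -> : @Normc.normc R = (fun xy => Num.sqrt (xy.1 ^+ 2 + xy.2 ^+ 2)) \o ReIm.
  by apply/funext => -[].
apply: measurableT_comp => //; apply: measurableT_comp.
  exact: continuous_measurable_fun (@sqrt_continuous R).
apply: measurable_funD; apply: measurable_funX;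
  [exact: measurable_fst|exact: measurable_snd].
Qed.

Lemma measurable_rate d (T : measurableType d) (beta W : R) (A : nat)
    (rho : 'I_A -> R) (h : 'I_A -> T -> R[i]) :
  (forall a, measurable_fun setT (h a)) ->
  measurable_fun setT (fun t => rate beta W rho (h^~ t)).
Proof.
move=> mh; rewrite /rate /log2.
apply: measurable_funM => //; apply: measurable_funM => //.
apply: (measurableT_comp (@measurable_ln R)).
apply: measurable_funD => //; apply: measurable_sum => a.
apply: measurable_funM => //; apply: measurable_funX.
exact: measurableT_comp measurable_normc (mh a).
Qed.

Lemma gain_ge0 (A : nat) (rho : 'I_A -> R) (h : 'I_A -> R[i]) :
  (forall a, 0 < rho a) -> 0 <= \sum_(a < A) rho a * Normc.normc (h a) ^+ 2.
Proof. by move=> r0; apply: sumr_ge0 => a _; rewrite mulr_ge0 ?sqr_ge0// ltW. Qed.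

Lemma ln2_gt0 : 0 < ln 2 :> R.
Proof. by apply: ln_gt0; rewrite ltr1n. Qed.

Lemma rate_ge0 (beta W : R) (A : nat) (rho : 'I_A -> R) (h : 'I_A -> R[i]) :
  0 < beta -> 0 < W -> (forall a, 0 < rho a) -> 0 <= rate beta W rho h.
Proof.
move=> b0 W0 r0; rewrite /rate /log2 !mulr_ge0 ?invr_ge0 ?(ltW b0) ?(ltW W0)//.
  by rewrite ln_ge0// lerDl gain_ge0.
exact/ltW/ln2_gt0.
Qed.

(** Inverting the logarithm places a level set of the rate inside a level set of the channel gain,
    which is a sum of independent terms. *)
Lemma gain_of_rate (beta W : R) (A : nat) (rho : 'I_A -> R) (h : 'I_A -> R[i]) c :
  0 < beta -> 0 < W -> (forall a, 0 < rho a) -> rate beta W rho h = c ->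
  \sum_(a < A) rho a * Normc.normc (h a) ^+ 2 =
    expR (c / (beta * W) * ln 2) - 1.
Proof.
move=> b0 W0 r0 <-; rewrite /rate /log2.
have := @gain_ge0 A rho h r0; set S := \sum_(a < A) _ => S0.
rewrite [_ / (beta * W)]mulrAC divff ?mul1r; last by rewrite gt_eqF// mulr_gt0.
rewrite divfK; last by rewrite gt_eqF// ln2_gt0.
rewrite lnK; last by rewrite posrE ltr_pwDl.
by rewrite [1 + S]addrC addrK.
Qed.

Lemma airtime_ge B c r : 0 < B -> 0 <= r -> r <= c ->
  ((B / c)%:E <= airtime B r)%E.
Proof.
move=> B0; rewrite le_eqVlt => /orP[/eqP <- _|r0 rc].
  (* At rate zero the airtime is [+oo]. *)
  by rewrite /airtime inve0 mulry gtr0_sg// mul1e leey.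
rewrite /airtime inver gt_eqF// -EFinM lee_fin ler_pM2l// lef_pV2//.
by rewrite posrE (lt_le_trans r0).
Qed.

Lemma airtime_gt B c r : 0 < B -> 0 <= r -> r < c ->
  ((B / c)%:E < airtime B r)%E.
Proof.
move=> B0; rewrite le_eqVlt => /orP[/eqP <- _|r0 rc].
  by rewrite /airtime inve0 mulry gtr0_sg// mul1e ltey.
rewrite /airtime inver gt_eqF// -EFinM lte_fin ltr_pM2l// ltf_pV2//.
by rewrite posrE (lt_trans r0).
Qed.

Lemma airtime_le B c r : 0 < B -> 0 < c -> c < r ->
  (airtime B r <= (B / c)%:E)%E.
Proof.
move=> B0 c0 cr; have r0 := lt_trans c0 cr.
by rewrite /airtime inver gt_eqF// -EFinM lee_fin ler_pM2l// lef_pV2// ltW.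
Qed.

Lemma measurable_airtime d (T : measurableType d) B (f : T -> R) :
  (forall t, 0 <= f t) -> measurable_fun setT f ->
  measurable_fun setT (fun t => airtime B (f t)).
Proof.
move=> f0 mf.
(* The inverse is written expR (- ln _), whose measurability is known. *)
have -> : (fun t => airtime B (f t)) =
    (fun t => if f t <= 0 then (B%:E * +oo)%E else (B * expR (- ln (f t)))%:E).
  apply/funext => t; rewrite /airtime inver; have := f0 t.
  rewrite le_eqVlt => /orP[/eqP <-|ft]; first by rewrite eqxx lexx.
  by rewrite gt_eqF// leNgt ft/= expRN lnK// -EFinM.
apply: measurable_fun_ifT => //; first exact: measurable_fun_ler.
apply/measurable_EFinP; apply: measurable_funM => //.
apply: measurableT_comp => //; apply: measurableT_comp => //.
exact: measurableT_comp (@measurable_ln R) mf.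
Qed.

End rate_airtime.

(** * Rates have no atoms *)

(** The gain splits as [X + Y], with [X] contributed by one access point and [Y] by the others. [X]
    is atomless and independent of [Y], so the sum is atomless too. *)
Lemma rate_no_atoms (disp : measure_display) (T : measurableType disp)
    (R : realType) (P : probability T R) (A D : nat) (W beta : R)
    (rho : 'I_D -> 'I_A -> R) (s : 'I_D -> 'I_A -> R)
    (h : 'I_D -> 'I_A -> {RV P >-> R[i]}) (d : 'I_D) (c : R) :
  (0 < A)%N -> 0 < W -> 0 < beta -> (forall d a, 0 < rho d a) ->
  (forall d a, has_law (h d a) (complex_normal_prob (s d a))) ->
  mutually_independent (fun da : 'I_D * 'I_A => h da.1 da.2) ->
  P [set t | rate beta W (rho d) (fun a => h d a t) = c] = 0%E.
Proof.
move=> A0 W0 b0 rho0 h_law indh; pose a0 := Ordinal A0.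
pose gain a z : R := rho d a * Normc.normc z ^+ 2.
have mgain a : measurable_fun setT (gain a).
  by apply: measurable_funM => //; apply: measurable_funX; exact: measurable_normc.
pose H (da : 'I_D * 'I_A) := h da.1 da.2.
(* Two groups: the single channel [(d, a0)], and all remaining channels, those of other devices
   included. *)
pose g da := da == (d, a0).
pose G := fiber_rectangles H g.
pose X t := gain a0 (h d a0 t).
pose Y t := \sum_(a < A) (if a != a0 then gain a (h d a t) else 0).
have mX : measurable_fun setT (X : g_sigma_algebraType (G true) -> R).
  apply: (measurableT_comp (mgain a0)).
  by apply: (@fiber_rectangles_RV _ T _ _ R P _ _ H g (d, a0)); exact: eqxx.
have mY : measurable_fun setT (Y : g_sigma_algebraType (G false) -> R).
  apply: measurable_sum => a; case: (boolP (a != a0)) => [a_a0|_] //.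
  apply: (measurableT_comp (mgain a)).
  apply: (@fiber_rectangles_RV _ T _ _ R P _ _ H g (d, a)).
  by rewrite /g xpair_eqE eqxx (negbTE a_a0).
have sG b (F : set T) : <<s G b >> F -> measurable F.
  apply: (smallest_sub (@sigma_algebra_measurable _ T)).
  exact: fiber_rectangles_measurable.
have mX' : measurable_fun setT X by move=> _ U mU; apply: sG; exact: mX.
have mY' : measurable_fun setT Y by move=> _ U mU; apply: sG; exact: mY.
have indXY U V : measurable U -> measurable V ->
    P (X @^-1` U `&` Y @^-1` V) = (P (X @^-1` U) * P (Y @^-1` V))%E.
  move=> mU mV.
  have := @mutually_independent_fibers _ T _ _ R P _ _ H g indh
    (fun b => if b then X @^-1` U else Y @^-1` V).
  rewrite big_bool => <-.
    congr (P _); apply/seteqP; split => [t [Xt Yt] []//|t XYt].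
    by split; [exact: (XYt true Logic.I)|exact: (XYt false Logic.I)].
  by case; [have := mX measurableT _ mU|have := mY measurableT _ mV];
    rewrite setTI.
have X0 k : P (X @^-1` [set k]) = 0%E.
  have mk : measurable [set z : R[i] | gain a0 z = k].
    by have := mgain a0 measurableT _ (measurable_set1 k); rewrite setTI.
  have := h_law d a0 _ mk; rewrite complex_normal_prob_circle0 //.
  by rewrite gt_eqF.
pose c' := expR (c / (beta * W) * ln 2) - 1.
have XYc' := @sum_no_atoms _ T R P (mfun_Sub (mem_set mX')) (mfun_Sub (mem_set mY'))
  c' indXY X0.
apply: (@subset_measure0 _ _ _ P _ [set t | X t + Y t = c']) => //.
- rewrite -[X in measurable X]setTI.
  have mrate := @measurable_rate R _ T beta W A (rho d) (fun a => h d a)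
    (fun a => measurable_funPT (h d a)).
  exact: (mrate measurableT _ (measurable_set1 c)).
- rewrite -[X in measurable X]setTI.
  exact: (measurable_funD mX' mY' measurableT (measurable_set1 c')).
move=> t /= /(gain_of_rate _ _ _ _ _ _ _ b0 W0 (rho0 d)).
by rewrite (bigD1 a0)//= (big_mkcond (fun i => i != a0)).
Qed.

(** * The two bounds on the overflow probability *)

Theorem proposition8 (disp : measure_display) (T : measurableType disp)
    (R : realType) (P : probability T R)
    (A D L : nat) (W B TD beta : R) (rho : 'I_D -> 'I_A -> R)
    (h : 'I_D -> 'I_A -> {RV P >-> R[i]})
    (hA : (1 <= A)%N) (hD : (1 <= D)%N) (hL : (1 <= L)%N)
    (hW : 0 < W) (hB : 0 < B) (hTD : 0 < TD) (hbeta : 0 < beta <= 1)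
    (hrho : forall d a, 0 < rho d a)
    (h_law : forall d a,
       has_law (h d a) (complex_normal_prob (1 - 1 / (1 + rho d a * L%:R))))
    (h_indep : mutually_independent (fun da : 'I_D * 'I_A => h da.1 da.2)) :
  let Rd (d : 'I_D) (t : T) : R :=
    rate beta W (rho d) (fun a => h d a t) in
  let TO : set T :=
    [set t | (TD%:E < \sum_(d < D) airtime B (Rd d t))%E] in
  (\prod_(d < D) P [set t | (Rd d t <= D%:R * B / TD)%R] <= P TO)%E /\
  (P TO <= 1 - \prod_(d < D) P [set t | (Rd d t > D%:R * B / TD)%R])%E.
Proof.
move=> Rd TO; have /andP[b0 _] := hbeta.
have D0 : 0 < D%:R :> R by rewrite ltr0n.
set c := D%:R * B / TD.
have c0 : 0 < c by rewrite divr_gt0 ?mulr_gt0.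
have Rd0 d t : 0 <= Rd d t by exact: rate_ge0.
pose H (da : 'I_D * 'I_A) := h da.1 da.2.
(* Grouping by the first index gathers the channels of each device. *)
pose G := fiber_rectangles H fst.
have mRdG d : measurable_fun setT (Rd d : g_sigma_algebraType (G d) -> R).
  apply: (@measurable_rate R _ (g_sigma_algebraType (G d)) beta W A (rho d)
    (fun a => h d a)) => a.
  exact: (@fiber_rectangles_RV _ T _ _ R P _ _ H fst (d, a)).
have mRd d : measurable_fun setT (Rd d).
  exact: (@measurable_rate R _ T beta W A (rho d) (fun a => h d a)
    (fun a => measurable_funPT (h d a))).
have indRd (S : set R) : measurable S ->
    (\prod_(d < D) P (Rd d @^-1` S))%E = P (\bigcap_d (Rd d @^-1` S)).
  move=> mS; apply/esym/(@mutually_independent_fibers _ T _ _ R P _ _ H fst) => //.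
  by move=> d; have := mRdG d measurableT _ mS; rewrite setTI.
have mI (S : set R) : measurable S -> measurable (\bigcap_d (Rd d @^-1` S)).
  move=> mS; apply: fin_bigcap_measurable => [|d _]; first exact: finite_finset.
  by rewrite -[X in measurable X]setTI; exact: mRd.
have mTO : measurable TO.
  rewrite -[TO]setTI; apply: emeasurable_fun_o_infty => //.
  by apply: emeasurable_sum => d; exact: measurable_airtime.
(* The time budget is cut into [D] equal shares [B / c], to be compared with the airtimes one by
   one. *)
have TDE : TD%:E = (\sum_(d < D) (B / c)%:E)%E.
  rewrite sumEFin sumr_const card_ord -[_ *+ D]mulr_natr /c; congr (_%:E).
  by field; rewrite !gt_eqF.
split.
- have mle : measurable [set r : R | r <= c].
    by rewrite -set_itvNyc; exact: measurable_itv.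
  rewrite (indRd _ mle); pose d0 := Ordinal hD.
  (* Excluding a tie at the single device [d0] is enough: one strict inequality makes the whole sum
     strict. *)
  pose N := [set t | Rd d0 t = c].
  have mN : measurable N.
    by have := mRd d0 measurableT _ (measurable_set1 c); rewrite setTI.
  have PN : P N = 0%E by exact: rate_no_atoms h_law h_indep.
  have sub : \bigcap_d (Rd d @^-1` [set r | r <= c]) `<=` TO `|` N.
    move=> t Rc; have [|/eqP Rd0c] := pselect (Rd d0 t = c); [by right|left].
    rewrite /TO/= TDE (bigD1 d0)//= [X in (_ < X)%E](bigD1 d0)//=.
    (* The shares of the other devices have a finite sum, so strictness at [d0] survives the
       addition even when airtimes are infinite. *)
    apply: lte_leD.
    + by rewrite sumEFin.
    + by apply: airtime_gt => //; rewrite lt_neqAle Rd0c; exact: Rc.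
    + by apply: lee_sum => d _; apply: airtime_ge => //; exact: Rc.
  apply: (@le_trans _ _ (P (TO `|` N))).
    by apply: le_measure => //; rewrite inE; [exact: mI|exact: measurableU].
  apply: (le_trans (measureU2 _ mTO mN)); apply: geeDl.
  by have := lexx (P N); rewrite {2}PN.
- have mgt : measurable [set r : R | c < r].
    by rewrite -set_itvoy; exact: measurable_itv.
  (* The right-hand side becomes the probability that some rate is at most [c], an event containing
     [TO]. *)
  rewrite (indRd _ mgt) -probability_setC; last exact: mI.
  apply: le_measure; rewrite ?inE//; first exact/measurableC/mI.
  move=> t TOt Rc; move: TOt; apply/negP; rewrite -leNgt TDE.
  by apply: lee_sum => d _; apply: airtime_le => //; exact: Rc.
Qed.
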